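(* Let $\mathbf{M}=M_{\star,\star}(\mathbb{Z}_+[t])$ be the prop of matrices with coefficients in $\mathbb{Z}_+[t]$, and let $\iota:\mathbf{M}\to\widehat{\mathbf{M}}$ be a traced completion of $\mathbf{M}$. For a square matrix $A$ over $\mathbb{Z}_+[t]$ of size $n\times n$, write $\tilde A=tr_n(\iota(A)):0\to0$, a morphism of $\widehat{\mathbf{M}}$. Let $M$ and $N$ be two square matrices with nonnegative integer coefficients. Then $\widetilde{tM}=\widetilde{tN}$ if and only if $M$ and $N$ are strong shift equivalent.
   Context: $\mathbb{Z}_+$ is the semiring of nonnegative integers and $\mathbb{Z}_+[t]$ the semiring of polynomials in $t$ with coefficients in $\mathbb{Z}_+$. Props. A prop is a strict symmetric monoidal category whose objects are the natural numbers, with tensor product on objects given by addition; $P[n,m]$ is the set of morphisms $n\to m$, $id:1\to1$ is the identity and $\sigma:2\to2$ the symmetry. A prop functor is an identity-on-objects strict symmetric monoidal functor. The prop $M_{\star,\star}(\mathbb{Z}_+[t])$: morphisms $n\to m$ are the $m\times n$ matrices over $\mathbb{Z}_+[t]$ (sizes may be $0$), $\circ$ is the matrix product, $A\otimes B=\begin{pmatrix}A&0\\0&B\end{pmatrix}$, and the symmetry $\sigma$ is $\begin{pmatrix}0&1\\1&0\end{pmatrix}$. Traced props. A traced prop is a prop with operators $tr$ sending each morphism $1+m\to 1+n$ to a morphism $m\to n$ (thought of as plugging the first output into the first input), such that, writing $tr_p$ for the $p$-th iterate of $tr$ ($tr_0(f)=f$): - (Tightening) $tr((id\otimes g)\circ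 f\circ(id\otimes h))=g\circ tr(f)\circ h$; - (Yanking) $tr(\sigma)=id$; - (Sliding) $tr_n(f\circ(g\otimes id^{\otimes p}))=tr_m((g\otimes id^{\otimes q})\circ f)$ for $f:m+p\to n+q$ and $g:n\to m$; - (Strength) $tr(f\otimes g)=tr(f)\otimes g$. A traced prop functor is a prop functor $F$ with $tr\,F(f)=F(tr\,f)$. Traced completion. A traced completion of a prop $P$ is a traced prop $\widehat P$ with a prop functor $\iota:P\to\widehat P$ such that for every traced prop $Q$ and prop functor $\eta:P\to Q$ there is a unique traced prop functor $G:\widehat P\to Q$ with $G\iota=\eta$. Strong shift equivalence (of nonnegative integer matrices) is the smallest equivalence relation $\equiv$ on square matrices over $\mathbb{Z}_+$ (of all sizes) such that $RS\equiv SR$ for all (not necessarily square) matrices $R,S$ over $\mathbb{Z}_+$ such that both products are defined. *)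

(* Defs.v *)
From mathcomp Require Import all_boot all_order all_algebra.

Set Implicit Arguments.
Unset Strict Implicit.
Unset Printing Implicit Defensive.

Import GRing.Theory.

(* Strictness equates the objects n + (m + p) and n + m + p, which are equal but
   not convertible; [hcast] transports morphisms along such equalities. *)
Definition hcast (hom : nat -> nat -> Type) (n n' m m' : nat)
    (en : n = n') (em : m = m') (f : hom n m) : hom n' m' :=
  ecast k (hom k m') en (ecast k (hom n k) em f).

Record prop := Prop_ {
  hom : nat -> nat -> Type;
  pid : forall n, hom n n;
  pcomp : forall n m k, hom m k -> hom n m -> hom n k;
  ptens : forall n m n' m',
    hom n m -> hom n' m' -> hom (n + n') (m + m');
  psym : forall m n, hom (m + n) (n + m);
  comp1p : forall n m (f : hom n m), pcomp (pid m) f = f;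
  compp1 : forall n m (f : hom n m), pcomp f (pid n) = f;
  compA : forall n m k l (h : hom k l) (g : hom m k) (f : hom n m),
    pcomp h (pcomp g f) = pcomp (pcomp h g) f;
  tens_id : forall n m, ptens (pid n) (pid m) = pid (n + m);
  tens_comp : forall n m k n' m' k' (g : hom m k) (f : hom n m)
      (g' : hom m' k') (f' : hom n' m'),
    ptens (pcomp g f) (pcomp g' f') = pcomp (ptens g g') (ptens f f');
  tens0p : forall n m (f : hom n m), ptens (pid 0) f = f;
  tensp0 : forall n m (f : hom n m),
    hcast (addn0 n) (addn0 m) (ptens f (pid 0)) = f;
  tensA : forall n m n' m' n'' m''
      (f : hom n m) (g : hom n' m') (h : hom n'' m''),
    hcast (addnA n n' n'') (addnA m m' m'') (ptens f (ptens g h))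
    = ptens (ptens f g) h;
  sym_nat : forall n m n' m' (f : hom n m) (g : hom n' m'),
    pcomp (psym m m') (ptens f g) = pcomp (ptens g f) (psym n n');
  symK : forall m n, pcomp (psym n m) (psym m n) = pid (m + n);
  sym0 : forall n, hcast (addn0 n) (erefl n) (psym n 0) = pid n;
  sym_hexagon : forall m n p,
    hcast (erefl (m + (n + p))) (esym (addnA n p m)) (psym m (n + p))
    = pcomp (ptens (pid n) (psym m p))
            (hcast (esym (addnA m n p)) (esym (addnA n m p))
                   (ptens (psym m n) (pid p)))
}.

Arguments pid {P} n : rename.
Arguments pcomp {P n m k} g f : rename.
Arguments ptens {P n m n' m'} f g : rename.
Arguments psym {P} m n : rename.

Record prop_functor (P Q : prop) := PropFunctor {
  fmap :> forall n m, hom P n m -> hom Q n m;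
  fmap_id : forall n, fmap (pid n) = pid n;
  fmap_comp : forall n m k (g : hom P m k) (f : hom P n m),
    fmap (pcomp g f) = pcomp (fmap g) (fmap f);
  fmap_tens : forall n m n' m' (f : hom P n m) (g : hom P n' m'),
    fmap (ptens f g) = ptens (fmap f) (fmap g);
  fmap_sym : forall m n, fmap (psym m n) = psym m n
}.

Arguments fmap {P Q} F {n m} f : rename.

Fixpoint tr_iter (hom : nat -> nat -> Type)
    (tr : forall n m, hom (1 + n) (1 + m) -> hom n m) (p n m : nat) :
    hom (p + n) (p + m) -> hom n m :=
  match p with
  | 0 => fun f => f
  | p'.+1 => fun f => tr_iter tr (tr (p' + n) (p' + m) f)
  end.

(* The traced wire is the first one; [1 + n] and [0 + n] reduce to [n.+1] and
   [n], so no transport is needed in the trace axioms. *)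
Record traced_prop := TracedProp {
  tprop :> prop;
  tr : forall n m, hom tprop (1 + n) (1 + m) -> hom tprop n m;
  tr_tightening : forall n m n' m' (g : hom tprop m m')
      (f : hom tprop (1 + n) (1 + m)) (h : hom tprop n' n),
    tr (pcomp (ptens (pid 1) g) (pcomp f (ptens (pid 1) h)))
    = pcomp g (pcomp (tr f) h);
  tr_yanking : tr (psym 1 1) = pid 1;
  tr_sliding : forall m n p q (f : hom tprop (m + p) (n + q))
      (g : hom tprop n m),
    tr_iter tr (p := n) (pcomp f (ptens g (pid p)))
    = tr_iter tr (p := m) (pcomp (ptens g (pid q)) f);
  tr_strength : forall n m n' m' (f : hom tprop (1 + n) (1 + m))
      (g : hom tprop n' m'),
    tr (ptens f g : hom tprop (1 + (n + n')) (1 + (m + m'))) = ptens (tr f) g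
}.

Arguments tr {P n m} f : rename.

Definition trn (P : traced_prop) (p n m : nat) :
    hom P (p + n) (p + m) -> hom P n m :=
  @tr_iter (hom P) (@tr P) p n m.

Arguments trn {P} p {n m} f.

Record traced_functor (P Q : traced_prop) := TracedFunctor {
  tfunctor :> prop_functor P Q;
  fmap_tr : forall n m (f : hom P (1 + n) (1 + m)),
    tr (tfunctor _ _ f) = tfunctor _ _ (tr f)
}.

(* Functors are compared by their action on morphisms, so that uniqueness does
   not depend on the proofs stored in the records. *)
Definition is_traced_completion (P : prop) (Phat : traced_prop)
    (iota : prop_functor P Phat) : Prop :=
  forall (Q : traced_prop) (eta : prop_functor P Q),
    exists G : traced_functor Phat Q,
      (forall n m (f : hom P n m), fmap G (fmap iota f) = fmap eta f) /\
      (forall G' : traced_functor Phat Q,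
        (forall n m (f : hom P n m), fmap G' (fmap iota f) = fmap eta f) ->
        forall n m (f : hom Phat n m), fmap G' f = fmap G f).

Section MatrixProp.
Local Open Scope ring_scope.
Variable R : pzSemiRingType.

(* A morphism n -> m has m rows and n columns. *)
Definition mhom (n m : nat) : Type := 'M[R]_(m, n).

Definition mid (n : nat) : mhom n n := 1%:M.

Definition mcomp (n m k : nat) (g : mhom m k) (f : mhom n m) : mhom n k :=
  g *m f.

Definition mtens (n m n' m' : nat) (f : mhom n m) (g : mhom n' m') :
    mhom (n + n') (m + m') :=
  block_mx f 0 0 g.

Definition msym (m n : nat) : mhom (m + n) (n + m) :=
  block_mx 0 1%:M 1%:M 0.

Lemma hcast_mx n n' m m' (en : n = n') (em : m = m') (f : mhom n m) :
  hcast en em f = castmx (em, en) f.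
Proof. by case: n' / en; case: m' / em. Qed.

Lemma mcomp1p n m (f : mhom n m) : mcomp (mid m) f = f.
Proof. exact: mul1mx. Qed.

Lemma mcompp1 n m (f : mhom n m) : mcomp f (mid n) = f.
Proof. exact: mulmx1. Qed.

Lemma mcompA n m k l (h : mhom k l) (g : mhom m k) (f : mhom n m) :
  mcomp h (mcomp g f) = mcomp (mcomp h g) f.
Proof. exact: mulmxA. Qed.

Lemma mtens_id n m : mtens (mid n) (mid m) = mid (n + m).
Proof. by rewrite /mtens /mid scalar_mx_block. Qed.

Lemma mtens_comp n m k n' m' k' (g : mhom m k) (f : mhom n m)
    (g' : mhom m' k') (f' : mhom n' m') :
  mtens (mcomp g f) (mcomp g' f') = mcomp (mtens g g') (mtens f f').
Proof.
by rewrite /mtens /mcomp mulmx_block !mulmx0 !mul0mx !addr0 !add0r.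
Qed.

Lemma mtens0p n m (f : mhom n m) : mtens (mid 0) f = f.
Proof.
apply/matrixP=> i j.
have -> : i = rshift 0 (i : 'I_m) by apply: val_inj.
have -> : j = rshift 0 (j : 'I_n) by apply: val_inj.
by rewrite /mtens block_mxEdr; congr (f _ _); apply: val_inj.
Qed.

Lemma mtensp0 n m (f : mhom n m) :
  hcast (addn0 n) (addn0 m) (mtens f (mid 0)) = f.
Proof.
rewrite hcast_mx; apply/matrixP=> i j; rewrite castmxE.
have -> : cast_ord (esym (addn0 m)) i = lshift 0 i by apply: val_inj.
have -> : cast_ord (esym (addn0 n)) j = lshift 0 j by apply: val_inj.
by rewrite /mtens block_mxEul.
Qed.

Lemma mtensA n m n' m' n'' m''
    (f : mhom n m) (g : mhom n' m') (h : mhom n'' m'') :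
  hcast (addnA n n' n'') (addnA m m' m'') (mtens f (mtens g h))
  = mtens (mtens f g) h.
Proof.
rewrite hcast_mx /mtens -row_mx0 -col_mx0 block_mxA castmx_comp castmx_id.
by rewrite row_mx0 col_mx0.
Qed.

Lemma msym_nat n m n' m' (f : mhom n m) (g : mhom n' m') :
  mcomp (msym m m') (mtens f g) = mcomp (mtens g f) (msym n n').
Proof.
rewrite /mcomp /msym /mtens !mulmx_block !mul0mx !mulmx0 !mul1mx !mulmx1.
by rewrite !add0r !addr0.
Qed.

Lemma msymK m n : mcomp (msym n m) (msym m n) = mid (m + n).
Proof.
rewrite /mcomp /msym /mid mulmx_block !mul0mx !mulmx0 !mul1mx.
by rewrite !add0r !addr0 scalar_mx_block.
Qed.

Lemma msym0 n : hcast (addn0 n) (erefl n) (msym n 0) = mid n.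
Proof.
rewrite hcast_mx; apply/matrixP=> i j; rewrite castmxE.
have -> : cast_ord (esym (erefl n)) i = rshift 0 (i : 'I_n) by apply: val_inj.
have -> : cast_ord (esym (addn0 n)) j = lshift 0 j by apply: val_inj.
exact: etrans (block_mxEdl _ _ _ _ _ _) _.
Qed.

Lemma msym_hexagon m n p :
  hcast (erefl (m + (n + p))%N) (esym (addnA n p m)) (msym m (n + p))
  = mcomp (mtens (mid n) (msym m p))
          (hcast (esym (addnA m n p)) (esym (addnA n m p))
                 (mtens (msym m n) (mid p))).
Proof.
rewrite !hcast_mx /mcomp /mtens /msym /mid.
rewrite -[X in block_mx (block_mx _ _ _ _) X _ _]col_mx0.
rewrite -[X in block_mx (block_mx _ _ _ _) _ X _]row_mx0 -block_mxA.
rewrite mulmx_block !mul0mx !mulmx0 !mul1mx !add0r !addr0.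
rewrite mul_block_col mulmx_block !mul0mx !mulmx0 !mul1mx !add0r !addr0.
rewrite (scalar_mx_block n p) -[X in block_mx X _ _ 0]col_mx0.
rewrite [in LHS]/block_mx -block_mxEh [in LHS]/block_mx -col_mxA.
by rewrite [in RHS]/block_mx -block_mxEh [in RHS]/block_mx !row_mx0.
Qed.

Definition matrix_prop : prop :=
  Prop_ mcomp1p mcompp1 mcompA mtens_id mtens_comp mtens0p mtensp0 mtensA
        msym_nat msymK msym0 msym_hexagon.

End MatrixProp.

Arguments matrix_prop R : clear implicits.

Definition polymx_prop : prop := matrix_prop {poly nat}.

(* [trn n] expects a morphism n + 0 -> n + 0, whence the transport. *)
Definition tilde (Phat : traced_prop) (iota : prop_functor polymx_prop Phat)
    (n : nat) (A : 'M[{poly nat}]_n) : hom Phat 0 0 :=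
  trn n (hcast (esym (addn0 n)) (esym (addn0 n))
               (fmap iota (A : hom polymx_prop n n))).

Definition tmx (n : nat) (M : 'M[nat]_n) : 'M[{poly nat}]_n :=
  ('X *: map_mx polyC M)%R.

(* Strong shift equivalence relates matrices of different sizes, including 0. *)
Inductive sse : forall m n : nat, 'M[nat]_m -> 'M[nat]_n -> Prop :=
| sse_mul m n (R : 'M[nat]_(m, n)) (S : 'M[nat]_(n, m)) :
    sse (R *m S)%R (S *m R)%R
| sse_refl m (M : 'M[nat]_m) : sse M M
| sse_sym m n (M : 'M[nat]_m) (N : 'M[nat]_n) : sse M N -> sse N M
| sse_trans m n p (M : 'M[nat]_m) (N : 'M[nat]_n) (L : 'M[nat]_p) :
    sse M N -> sse N L -> sse M L.

(* Main.v *)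
Require Import Defs.
From mathcomp Require Import all_boot all_order all_algebra.
From HB Require Import structures.
From mathcomp Require Import boolp.
From Stdlib Require Import Relation_Operators.

(* If M = RS and N = SR then tM = (tR)S and tN = S(tR), so the traces agree by
   sliding.  For the converse, it suffices to map M(Z+[t]) into one traced prop
   in which the closed morphism of tM remembers the strong shift equivalence
   class of M.  Its morphisms n -> m are discrete-time linear systems
   x' = A x + B u, y = C x + D u over nat, the indeterminate t being a unit
   delay; two systems are identified when the state can be pushed through a
   factorization of the transition matrix: (hg, B, Cg, D) ~ (gh, gB, C, D).  On
   systems without ports this is exactly strong shift equivalence.  The trace
   closes instantaneous links and is replaced by an absorbing morphism None as
   soon as these links contain a cycle; without cycles the matrix D of links has
   a star X = 1 + DX = 1 + XD, and sliding comes from (GF)* = 1 + G (FG)* F.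
   Finally a polynomial matrix is sent to any acyclic system whose impulse
   response is its sequence of coefficients: acyclic systems with the same
   impulse response are identified, which makes this a functor. *)

Set Implicit Arguments.
Unset Strict Implicit.
Unset Printing Implicit Defensive.

Import GRing.Theory.
Local Open Scope ring_scope.
Local Open Scope quotient_scope.

Ltac mxblock := rewrite ?(mulmx_block, mul_row_block, mul_block_col, mul_row_col,
  mul_col_row, mul_mx_row, mul_col_mx, add_block_mx, add_row_mx, add_col_mx,
  mulmx1, mul1mx, mulmx0, mul0mx, addr0, add0r, row_mx0, col_mx0, block_mx0).

(** * Matrices with an empty dimension *)

Lemma mx0r (R : Type) m (A B : 'M[R]_(0, m)) : A = B.
Proof. by apply/matrixP=> -[]. Qed.

Lemma mx0c (R : Type) m (A B : 'M[R]_(m, 0)) : A = B.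
Proof. by apply/matrixP=> i -[]. Qed.

Section EmptyBlocks.
Variable R : Type.

Lemma row_mx0l m n (A : 'M[R]_(m, 0)) (B : 'M_(m, n)) : row_mx A B = B.
Proof.
apply/matrixP=> i j; rewrite mxE.
by case: splitP => [[]//|k jk]; congr (B i _); apply: val_inj.
Qed.

Lemma col_mx0l m n (A : 'M[R]_(0, n)) (B : 'M_(m, n)) : col_mx A B = B.
Proof.
apply/matrixP=> i j; rewrite mxE.
by case: splitP => [[]//|k jk]; congr (B _ j); apply: val_inj.
Qed.

End EmptyBlocks.

(** * Linear systems up to strong shift equivalence *)

(* [sA] is the state transition (delayed by one step), [sB] the input map, [sC]
   the output map and [sD] the instantaneous link from inputs to outputs. *)
Record sys (n m : nat) := Sys {
  sdim : nat;
  sA : 'M[nat]_sdim;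
  sB : 'M[nat]_(sdim, n);
  sC : 'M[nat]_(m, sdim);
  sD : 'M[nat]_(m, n)
}.

Arguments Sys {n m sdim} sA sB sC sD.

Definition step n m (x y : sys n m) : Prop :=
  exists (g : 'M[nat]_(sdim y, sdim x)) (h : 'M[nat]_(sdim x, sdim y)),
    [/\ h *m g = sA x, g *m h = sA y, g *m sB x = sB y,
        sC y *m g = sC x & sD x = sD y].

Definition sequiv n m : sys n m -> sys n m -> Prop :=
  clos_refl_sym_trans _ (@step n m).

Section EquivLemmas.
Variables n m : nat.
Implicit Types x y z : sys n m.

Lemma sequiv_step x y : step x y -> sequiv x y.
Proof. exact: rst_step. Qed.

Lemma sequivxx x : sequiv x x.
Proof. exact: rst_refl. Qed.

Lemma sequivC x y : sequiv x y -> sequiv y x.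
Proof. exact: rst_sym. Qed.

Lemma sequivT x y z : sequiv x y -> sequiv y z -> sequiv x z.
Proof. exact: rst_trans. Qed.

Lemma sequiv_sD x y : sequiv x y -> sD x = sD y.
Proof. by elim=> // [u v [g [h []]]|u v w _ -> _ ->]. Qed.

(** Reduces the congruence of each connection of systems to the case of a single step. *)
Lemma sequiv_map n' m' (F : sys n m -> sys n' m') :
  (forall x y, step x y -> step (F x) (F y)) ->
  forall x y, sequiv x y -> sequiv (F x) (F y).
Proof.
move=> hF x y; elim=> {x y} [x y xy|x|x y _|x y z _ xy _ yz].
- exact/rst_step/hF.
- exact: rst_refl.
- exact: rst_sym.
- exact: rst_trans xy yz.
Qed.

(** A change of basis of the state is a single step: with [h := A *m g'], the inverse relations turn
    [h *m g] into [A] and [g *m h] into [A']. *)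
Lemma sequiv_iso k k' (g : 'M[nat]_(k', k)) (g' : 'M[nat]_(k, k'))
    (A : 'M_k) (B : 'M_(k, n)) (C : 'M_(m, k)) D
    (A' : 'M_k') (B' : 'M_(k', n)) (C' : 'M_(m, k')) :
  g *m g' = 1%:M -> g' *m g = 1%:M -> g *m A = A' *m g ->
  g *m B = B' -> C' *m g = C -> sequiv (Sys A B C D) (Sys A' B' C' D).
Proof.
move=> gg' g'g gA gB Cg; apply: sequiv_step; exists g, (A *m g').
by rewrite /= mulmxA gA -!mulmxA gg' g'g !mulmx1.
Qed.

Lemma sequiv_castdim k k' (e : k = k') (A : 'M_k) (B : 'M_(k, n))
    (C : 'M_(m, k)) D :
  sequiv (Sys A B C D)
    (Sys (castmx (e, e) A) (castmx (e, erefl) B) (castmx (erefl, e) C) D).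
Proof. by case: k' / e; rewrite !castmx_id; apply: sequivxx. Qed.

End EquivLemmas.

Definition semb n m (D : 'M[nat]_(m, n)) : sys n m := @Sys n m 0 0 0 0 D.

(** Series connection. The states of [y] precede those of [x], which they only read, so the
    transition matrix is block upper triangular; strictly upper triangular systems are therefore
    closed under composition. *)
Definition scomp n m k (y : sys m k) (x : sys n m) : sys n k :=
  Sys (block_mx (sA y) (sB y *m sC x) 0 (sA x))
      (col_mx (sB y *m sD x) (sB x))
      (row_mx (sC y) (sD y *m sC x))
      (sD y *m sD x).

Definition stens n m n' m' (x : sys n m) (y : sys n' m') :
    sys (n + n') (m + m') :=
  Sys (block_mx (sA x) 0 0 (sA y)) (block_mx (sB x) 0 0 (sB y))
      (block_mx (sC x) 0 0 (sC y)) (block_mx (sD x) 0 0 (sD y)).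

(* The first [p] outputs are plugged into the first [p] inputs; [X] is meant to
   be a star of the links among these ports. *)
Definition sclose p n m (x : sys (p + n) (p + m)) (X : 'M[nat]_p) : sys n m :=
  Sys (sA x + lsubmx (sB x) *m X *m usubmx (sC x))
      (rsubmx (sB x) + lsubmx (sB x) *m X *m ursubmx (sD x))
      (dsubmx (sC x) + dlsubmx (sD x) *m X *m usubmx (sC x))
      (drsubmx (sD x) + dlsubmx (sD x) *m X *m ursubmx (sD x)).

Definition scast n m n' m' (en : n = n') (em : m = m') (x : sys n m) : sys n' m' :=
  Sys (sA x) (castmx (erefl, en) (sB x)) (castmx (em, erefl) (sC x))
      (castmx (em, en) (sD x)).

Lemma hcast_sys n m n' m' (en : n = n') (em : m = m') (x : sys n m) :
  hcast en em x = scast en em x.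
Proof.
case: n' / en; case: m' / em; rewrite /scast !castmx_id.
by case: x.
Qed.

Lemma sys0E n m (A : 'M_0) B C D : @Sys n m 0 A B C D = semb D.
Proof. by rewrite /semb; congr Sys; (exact: mx0r || exact: mx0c). Qed.

Lemma scomp_stepl n m k (y y' : sys m k) (x : sys n m) :
  step y y' -> step (scomp y x) (scomp y' x).
Proof.
case: y y' => [k1 A1 B1 C1 D1] [k2 A2 B2 C2 D2] [/= g [h [/= <- <- <- <- ->]]].
(* The map [g] acts on the states of [y] alone; the coupling with [x] and the dynamics of [x] are
   placed entirely in the other factor. *)
exists (block_mx g 0 0 1%:M), (block_mx h (B1 *m sC x) 0 (sA x)).
by split=> //=; mxblock; rewrite ?mulmxA.
Qed.

Lemma scomp_stepr n m k (y : sys m k) (x x' : sys n m) :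
  step x x' -> step (scomp y x) (scomp y x').
Proof.
case: x x' => [k1 A1 B1 C1 D1] [k2 A2 B2 C2 D2] [/= g [h [/= <- <- <- <- ->]]].
exists (block_mx 1%:M 0 0 g), (block_mx (sA y) (sB y *m C2) 0 h).
by split=> //=; mxblock; rewrite ?mulmxA.
Qed.

Lemma scomp_sequiv n m k (y y' : sys m k) (x x' : sys n m) :
  sequiv y y' -> sequiv x x' -> sequiv (scomp y x) (scomp y' x').
Proof.
move=> yy' xx'; apply: (sequivT (y := scomp y x')).
  by apply: (sequiv_map (F := scomp y)) xx' => u v; exact: scomp_stepr.
by apply: (sequiv_map (F := fun u => scomp u x')) yy' => u v; exact: scomp_stepl.
Qed.

Lemma stens_stepl n m n' m' (x x' : sys n m) (y : sys n' m') :
  step x x' -> step (stens x y) (stens x' y).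
Proof.
case: x x' => [k1 A1 B1 C1 D1] [k2 A2 B2 C2 D2] [/= g [h [/= <- <- <- <- ->]]].
exists (block_mx g 0 0 1%:M), (block_mx h 0 0 (sA y)).
by split=> //=; mxblock.
Qed.

Lemma stens_stepr n m n' m' (y : sys n m) (x x' : sys n' m') :
  step x x' -> step (stens y x) (stens y x').
Proof.
case: x x' => [k1 A1 B1 C1 D1] [k2 A2 B2 C2 D2] [/= g [h [/= <- <- <- <- ->]]].
exists (block_mx 1%:M 0 0 g), (block_mx (sA y) 0 0 h).
by split=> //=; mxblock.
Qed.

Lemma stens_sequiv n m n' m' (x x' : sys n m) (y y' : sys n' m') :
  sequiv x x' -> sequiv y y' -> sequiv (stens x y) (stens x' y').
Proof.
move=> xx' yy'; apply: (sequivT (y := stens x y')).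
  by apply: (sequiv_map (F := stens x)) yy' => u v; exact: stens_stepr.
by apply: (sequiv_map (F := fun u => stens u y')) xx' => u v;
  exact: stens_stepl.
Qed.

Lemma sclose_sequiv p n m (x x' : sys (p + n) (p + m)) (X : 'M_p) :
  sequiv x x' -> sequiv (sclose x X) (sclose x' X).
Proof.
apply: (sequiv_map (F := fun u => sclose u X)) => {x x'}.
case=> [k1 A1 B1 C1 D1] [k2 A2 B2 C2 D2] [/= g [h [/= <- <- <- <- ->]]].
rewrite -[B1]hsubmxK -[C2]vsubmxK; set B11 := lsubmx B1; set B12 := rsubmx B1.
set C21 := usubmx C2; set C22 := dsubmx C2.
(* The output map of the first system is [C2 *m g], so the feedback term also factors through [g]
   and can be absorbed into [h]. *)
exists g, (h + B11 *m X *m C21).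
split=> //=; rewrite ?mul_mx_row ?mul_col_mx.
- by rewrite row_mxKl col_mxKu mulmxDl !mulmxA.
- by rewrite row_mxKl col_mxKu mulmxDr !mulmxA.
- by rewrite !row_mxKl !row_mxKr mulmxDr !mulmxA.
- by rewrite !col_mxKu !col_mxKd mulmxDl !mulmxA.
Qed.

Lemma block_mx0l (R : Type) m n (A : 'M[R]_0) (B : 'M_(0, n)) (C : 'M_(m, 0))
    (D : 'M_(m, n)) : block_mx A B C D = D.
Proof. by rewrite /block_mx col_mx0l row_mx0l. Qed.

Lemma scomp_semb n m k (y : 'M_(k, m)) (x : 'M_(m, n)) :
  scomp (semb y) (semb x) = semb (y *m x).
Proof. exact: sys0E. Qed.

Lemma stens_semb n m n' m' (x : 'M_(m, n)) (y : 'M_(m', n')) :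
  stens (semb x) (semb y) = semb (block_mx x 0 0 y).
Proof. exact: sys0E. Qed.

Lemma scomp_embl n m k (y : 'M_(k, m)) (x : sys n m) :
  scomp (semb y) x = Sys (sA x) (sB x) (y *m sC x) (y *m sD x).
Proof. by congr Sys; rewrite /= ?block_mx0l // ?col_mx0l ?row_mx0l. Qed.

Lemma scomp_embr n m k (y : sys m k) (x : 'M_(m, n)) :
  sequiv (scomp y (semb x)) (Sys (sA y) (sB y *m x) (sC y) (sD y *m x)).
Proof.
apply: (@sequiv_iso _ _ _ _ (row_mx 1%:M 0) (col_mx 1%:M 0)) => //=; mxblock=> //.
by rewrite scalar_mx_block; congr block_mx; (exact: mx0r || exact: mx0c).
Qed.

Lemma stens_embl n m n' m' (x : 'M_(m, n)) (y : sys n' m') :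
  stens (semb x) y =
    Sys (sA y) (row_mx 0 (sB y)) (col_mx 0 (sC y)) (block_mx x 0 0 (sD y)).
Proof.
congr Sys; rewrite /= ?block_mx0l //.
  by rewrite /block_mx col_mx0l.
by rewrite /block_mx !row_mx0l.
Qed.

Lemma stens_embr n m n' m' (x : sys n m) (y : 'M_(m', n')) :
  sequiv (stens x (semb y))
    (Sys (sA x) (row_mx (sB x) 0) (col_mx (sC x) 0) (block_mx (sD x) 0 0 y)).
Proof.
apply: (@sequiv_iso _ _ _ _ (row_mx 1%:M 0) (col_mx 1%:M 0)) => //=; mxblock=> //.
  by rewrite scalar_mx_block; congr block_mx; (exact: mx0r || exact: mx0c).
Qed.

Lemma scomp1s n m (x : sys n m) : scomp (semb 1%:M) x = x.
Proof. by rewrite scomp_embl !mul1mx; case: x. Qed.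

Lemma scomps1 n m (x : sys n m) : sequiv (scomp x (semb 1%:M)) x.
Proof.
apply: sequivT (scomp_embr _ _) _.
by rewrite !mulmx1; case: x => *; exact: sequivxx.
Qed.

Lemma scompA n m k l (z : sys k l) (y : sys m k) (x : sys n m) :
  sequiv (scomp z (scomp y x)) (scomp (scomp z y) x).
Proof.
apply: sequivT (sequiv_castdim (addnA _ _ _) _ _ _ _) _.
rewrite /scomp /=; mxblock.
rewrite -[X in block_mx _ _ X (block_mx _ _ _ _)]col_mx0 block_mxA row_mxA.
rewrite col_mxA !castmx_comp !castmx_id row_mx0 !mulmxA.
exact: sequivxx.
Qed.

(** Permutation matrix exchanging the two middle blocks. It reorders the states [(y, x), (y', x')]
    of a product of composites into [(y, y'), (x, x')]. *)
Definition midswap_mx (a b c d : nat) :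
    'M[nat]_((a + c) + (b + d), (a + b) + (c + d)) :=
  block_mx (block_mx 1%:M 0 0 0) (block_mx 0 0 1%:M 0)
           (block_mx 0 1%:M 0 0) (block_mx 0 0 0 1%:M).

Lemma midswap_mxK a b c d : midswap_mx a b c d *m midswap_mx a c b d = 1%:M.
Proof. by rewrite /midswap_mx; mxblock; rewrite -!scalar_mx_block. Qed.

Lemma stens_comp n m k n' m' k' (y : sys m k) (x : sys n m) (y' : sys m' k')
    (x' : sys n' m') :
  sequiv (stens (scomp y x) (scomp y' x')) (scomp (stens y y') (stens x x')).
Proof.
rewrite /stens /scomp /=; mxblock.
apply: (sequiv_iso _ (midswap_mxK _ _ _ _) (midswap_mxK _ _ _ _)).
all: by rewrite /midswap_mx; mxblock;
  rewrite /block_mx ?row_mx0 -?block_mxEh /block_mx ?row_mx0.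
Qed.

Lemma scast_sequiv n m n' m' (en : n = n') (em : m = m') (x y : sys n m) :
  sequiv x y -> sequiv (scast en em x) (scast en em y).
Proof.
by case: n' / en; case: m' / em; rewrite -!hcast_sys.
Qed.

Lemma stens0s n m (x : sys n m) : stens (semb (1%:M : 'M_0)) x = x.
Proof.
by rewrite stens_embl row_mx0l col_mx0l block_mx0l; case: x.
Qed.

Lemma castmx_row_mx0 k n (B : 'M[nat]_(k, n)) :
  castmx (erefl k, addn0 n) (row_mx B 0) = B.
Proof.
apply/matrixP=> i j; rewrite castmxE.
have -> : cast_ord (esym (addn0 n)) j = lshift 0 j by apply: val_inj.
by rewrite row_mxEl cast_ord_id.
Qed.

Lemma castmx_col_mx0 k n (B : 'M[nat]_(k, n)) :
  castmx (addn0 k, erefl n) (col_mx B 0) = B.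
Proof.
apply/matrixP=> i j; rewrite castmxE.
have -> : cast_ord (esym (addn0 k)) i = lshift 0 i by apply: val_inj.
by rewrite col_mxEu cast_ord_id.
Qed.

Lemma stenss0 n m (x : sys n m) :
  sequiv (scast (addn0 n) (addn0 m) (stens x (semb (1%:M : 'M_0)))) x.
Proof.
apply: sequivT (scast_sequiv _ _ (stens_embr _ _)) _.
rewrite /scast /= castmx_row_mx0 castmx_col_mx0 -hcast_mx mtensp0.
by case: x => *; exact: sequivxx.
Qed.

Lemma castmx_mtensA n m n' m' n'' m'' (e : (m + (m' + m'') = m + m' + m'')%N)
    (e' : (n + (n' + n'') = n + n' + n'')%N)
    (A : 'M[nat]_(m, n)) (B : 'M_(m', n')) (C : 'M_(m'', n'')) :
  castmx (e, e') (block_mx A 0 0 (block_mx B 0 0 C)) =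
  block_mx (block_mx A 0 0 B) 0 0 C.
Proof.
by rewrite -[RHS](mtensA A B C) hcast_mx (eq_irrelevance e (addnA _ _ _))
  (eq_irrelevance e' (addnA _ _ _)).
Qed.

Lemma stensA n m n' m' n'' m'' (x : sys n m) (y : sys n' m') (z : sys n'' m'') :
  sequiv (scast (addnA n n' n'') (addnA m m' m'') (stens x (stens y z)))
    (stens (stens x y) z).
Proof.
apply: sequivT (sequiv_castdim (addnA _ _ _) _ _ _ _) _.
by rewrite /scast /= !castmx_comp !castmx_mtensA; exact: sequivxx.
Qed.

Lemma ssym_nat n m n' m' (x : sys n m) (y : sys n' m') :
  sequiv (scomp (semb (msym nat m m')) (stens x y))
         (scomp (stens y x) (semb (msym nat n n'))).
Proof.
rewrite scomp_embl; apply: sequivC; apply: sequivT (scomp_embr _ _) _.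
rewrite /stens /= /msym; mxblock.
by apply: (@sequiv_iso _ _ _ _ (block_mx 0 1%:M 1%:M 0) (block_mx 0 1%:M 1%:M 0));
  mxblock; rewrite -?scalar_mx_block.
Qed.

Lemma scast_semb n m n' m' (en : n = n') (em : m = m') (x : 'M_(m, n)) :
  scast en em (semb x) = semb (castmx (em, en) x).
Proof. exact: sys0E. Qed.

(** * Closing wires *)

(* Over nat a star exists only if the links [D] carry no cycle. *)
Definition star_of p (D X : 'M[nat]_p) : Prop :=
  X = 1%:M + D *m X /\ X = 1%:M + X *m D.

Lemma scloseE p n m k (A : 'M_k) (B1 : 'M_(k, p)) (B2 : 'M_(k, n))
    (C1 : 'M_(p, k)) (C2 : 'M_(m, k)) D11 D12 D21 D22 (X : 'M_p) :
  sclose (Sys A (row_mx B1 B2) (col_mx C1 C2) (block_mx D11 D12 D21 D22)) X =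
  Sys (A + B1 *m X *m C1) (B2 + B1 *m X *m D12) (C2 + D21 *m X *m C1)
      (D22 + D21 *m X *m D12).
Proof.
by rewrite /sclose /= row_mxKl row_mxKr col_mxKu col_mxKd block_mxKur block_mxKdl
  block_mxKdr.
Qed.

(** An eliminator that splits the ports into explicit blocks, so that the projections in [sclose]
    compute. *)
Lemma sys_portsP p n m (P : sys (p + n) (p + m) -> Prop) :
  (forall k (A : 'M_k) B1 B2 C1 C2 D11 D12 D21 D22,
     P (Sys A (row_mx B1 B2) (col_mx C1 C2) (block_mx D11 D12 D21 D22))) ->
  forall x, P x.
Proof.
by move=> hP [k A B C D]; rewrite -[B]hsubmxK -[C]vsubmxK -[D]submxK; exact: hP.
Qed.

Lemma scomp_idtensl p n m m' k (A : 'M_k) (B1 : 'M_(k, p)) (B2 : 'M_(k, n))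
    (C1 : 'M_(p, k)) (C2 : 'M_(m, k)) D11 D12 D21 D22 (y : sys m m') :
  scomp (stens (semb (1%:M : 'M_p)) y)
        (Sys A (row_mx B1 B2) (col_mx C1 C2) (block_mx D11 D12 D21 D22)) =
  Sys (block_mx (sA y) (sB y *m C2) 0 A)
      (row_mx (col_mx (sB y *m D21) B1) (col_mx (sB y *m D22) B2))
      (col_mx (row_mx 0 C1) (row_mx (sC y) (sD y *m C2)))
      (block_mx D11 D12 (sD y *m D21) (sD y *m D22)).
Proof.
rewrite stens_embl /scomp /=; mxblock.
by congr Sys; rewrite /block_mx -?block_mxEh.
Qed.

Lemma scomp_idtensr p n n' m k (A : 'M_k) (B1 : 'M_(k, p)) (B2 : 'M_(k, n))
    (C1 : 'M_(p, k)) (C2 : 'M_(m, k)) D11 D12 D21 D22 (z : sys n' n) :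
  scomp (Sys A (row_mx B1 B2) (col_mx C1 C2) (block_mx D11 D12 D21 D22))
        (stens (semb (1%:M : 'M_p)) z) =
  Sys (block_mx A (B2 *m sC z) 0 (sA z))
      (row_mx (col_mx B1 0) (col_mx (B2 *m sD z) (sB z)))
      (col_mx (row_mx C1 (D12 *m sC z)) (row_mx C2 (D22 *m sC z)))
      (block_mx D11 (D12 *m sD z) D21 (D22 *m sD z)).
Proof.
rewrite stens_embl /scomp /=; mxblock.
by congr Sys; rewrite /block_mx -?block_mxEh.
Qed.

(** The closed wires meet only [x], so any [X] works. This is an equality and not just an
    equivalence: both sides list the states as [y], [x], [z], and an identity on the left
    contributes [0 + k] states, which reduces to [k]. *)
Lemma sclose_tightening p n m n' m' (y : sys m m') (x : sys (p + n) (p + m))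
    (z : sys n' n) (X : 'M_p) :
  sclose (scomp (stens (semb 1%:M) y) (scomp x (stens (semb 1%:M) z))) X =
  scomp y (scomp (sclose x X) z).
Proof.
elim/sys_portsP: x => k A B1 B2 C1 C2 D11 D12 D21 D22.
rewrite scomp_idtensr scomp_idtensl !scloseE /scomp /=.
congr Sys; mxblock; rewrite ?mulmxDl ?mulmxDr ?mulmxA //.
rewrite -block_mxEh [block_mx (sB y *m D21 *m X *m C1) _ _ _]/block_mx.
by rewrite -[X in row_mx X (col_mx _ _)]col_mx0 -!block_mxEh; mxblock.
Qed.

(** After a leading 1, both bracketings of the sum are convertible, so the transport of [row_mxA]
    disappears. *)
Lemma row_mx1A k n n' (A : 'M[nat]_(k, 1)) (B : 'M_(k, n)) (C : 'M_(k, n')) :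
  row_mx (row_mx A B) C = row_mx A (row_mx B C) :> 'M_(k, 1 + (n + n')).
Proof. by rewrite row_mxA [X in (_, X)](eq_irrelevance _ erefl) castmx_id. Qed.

Lemma col_mx1A k n n' (A : 'M[nat]_(1, k)) (B : 'M_(n, k)) (C : 'M_(n', k)) :
  col_mx (col_mx A B) C = col_mx A (col_mx B C) :> 'M_(1 + (n + n'), k).
Proof. by rewrite col_mxA [X in (X, _)](eq_irrelevance _ erefl) castmx_id. Qed.

Lemma stens1E n m n' m' k (A : 'M_k) B1 B2 C1 C2 D11 D12 D21 D22 (y : sys n' m') :
  stens (Sys A (row_mx B1 B2) (col_mx C1 C2)
             (block_mx D11 D12 D21 D22) : sys (1 + n) (1 + m)) y =
  Sys (block_mx A 0 0 (sA y))
      (row_mx (col_mx B1 0) (block_mx B2 0 0 (sB y)))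
      (col_mx (row_mx C1 0) (block_mx C2 0 0 (sC y)))
      (block_mx D11 (row_mx D12 0) (col_mx D21 0) (block_mx D22 0 0 (sD y)))
  :> sys (1 + (n + n')) (1 + (m + m')).
Proof.
congr Sys => /=.
- rewrite [LHS]/block_mx -[X in row_mx X (sB y)](@row_mx0 _ _ 1 n) !row_mx1A.
  exact: block_mxEh.
- rewrite [LHS]block_mxEh -[X in col_mx X (sC y)](@col_mx0 _ 1 m) !col_mx1A.
  apply: etrans (esym (block_mxEh C1 0 (col_mx C2 0) (col_mx 0 (sC y)))) _.
  by rewrite /block_mx -!block_mxEh.
- rewrite [LHS]block_mxEh {1}/block_mx.
  rewrite -[X in col_mx X (sD y)](@col_mx0 _ 1 m) !col_mx1A.
  apply: etrans (esym (block_mxEh (row_mx D11 D12) 0 (col_mx (row_mx D21 D22) 0)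
    (col_mx 0 (sD y)))) _.
  rewrite [LHS]/block_mx -block_mxEh /block_mx.
  rewrite -[X in col_mx _ (row_mx X (sD y))](@row_mx0 _ _ 1 n) !row_mx1A.
  by congr col_mx; rewrite -block_mxEh.
Qed.

Lemma sclose_strength n m n' m' (x : sys (1 + n) (1 + m)) (y : sys n' m')
    (X : 'M_1) :
  sclose (stens x y : sys (1 + (n + n')) (1 + (m + m'))) X =
  stens (sclose x X) y.
Proof.
elim/sys_portsP: x => k A B1 B2 C1 C2 D11 D12 D21 D22.
rewrite stens1E !scloseE.
by congr Sys => /=; mxblock; rewrite -[X in row_mx _ X]col_mx0 -block_mxEh; mxblock.
Qed.

(** Only an equivalence, unlike [scomp_idtensr]: an identity on the right leaves [sdim g + 0]
    states, which does not reduce. *)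
Lemma scomp_tensidr n m p q k (A : 'M_k) (B1 : 'M_(k, m)) (B2 : 'M_(k, p))
    (C1 : 'M_(n, k)) (C2 : 'M_(q, k)) D11 D12 D21 D22 (g : sys n m) :
  sequiv (scomp (Sys A (row_mx B1 B2) (col_mx C1 C2) (block_mx D11 D12 D21 D22))
                (stens g (semb 1%:M)))
    (Sys (block_mx A (B1 *m sC g) 0 (sA g))
         (row_mx (col_mx (B1 *m sD g) (sB g)) (col_mx B2 0))
         (col_mx (row_mx C1 (D11 *m sC g)) (row_mx C2 (D21 *m sC g)))
         (block_mx (D11 *m sD g) D12 (D21 *m sD g) D22)).
Proof.
apply: sequivT (scomp_sequiv (sequivxx _) (stens_embr _ _)) _.
rewrite /scomp /=; mxblock; rewrite -block_mxEh -!block_mxEv !block_mxEh.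
exact: sequivxx.
Qed.

Lemma scomp_tensidl n m p q k (A : 'M_k) (B1 : 'M_(k, m)) (B2 : 'M_(k, p))
    (C1 : 'M_(n, k)) (C2 : 'M_(q, k)) D11 D12 D21 D22 (g : sys n m) :
  sequiv (scomp (stens g (semb 1%:M))
                (Sys A (row_mx B1 B2) (col_mx C1 C2) (block_mx D11 D12 D21 D22)))
    (Sys (block_mx (sA g) (sB g *m C1) 0 A)
         (row_mx (col_mx (sB g *m D11) B1) (col_mx (sB g *m D12) B2))
         (col_mx (row_mx (sC g) (sD g *m C1)) (row_mx 0 C2))
         (block_mx (sD g *m D11) (sD g *m D12) D21 D22)).
Proof.
apply: sequivT (scomp_sequiv (stens_embr _ _) (sequivxx _)) _.
rewrite /scomp /=; mxblock; rewrite -block_mxEh -!block_mxEv !block_mxEh.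
exact: sequivxx.
Qed.

(** Unfolding the star once inside gives [G *m F + G *m F *m G *m X *m F = G *m (1 + F *m G *m X) *m
    F = G *m X *m F], and symmetrically on the other side. *)
Lemma star_slide n m (F : 'M_(n, m)) (G : 'M_(m, n)) X :
  star_of (F *m G) X -> star_of (G *m F) (1%:M + G *m X *m F).
Proof.
move=> [Xl Xr]; split.
  rewrite mulmxDr mulmx1; congr (_ + _).
  by rewrite {1}Xl !(mulmxDl, mulmxDr) mulmx1 !mulmxA.
rewrite mulmxDl mul1mx; congr (_ + _).
by rewrite {1}Xr !(mulmxDl, mulmxDr) mulmx1 !mulmxA.
Qed.

Lemma sclose_sliding n m p q (f : sys (m + p) (n + q)) (g : sys n m) X :
  star_of (ulsubmx (sD f) *m sD g) X ->
  sequiv (sclose (scomp f (stens g (semb 1%:M))) X)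
    (sclose (scomp (stens g (semb 1%:M)) f)
            (1%:M + sD g *m X *m ulsubmx (sD f))).
Proof.
case: f => k A B C D /=.
rewrite -[B]hsubmxK -[C]vsubmxK -[D]submxK block_mxKul.
move: (lsubmx B) (rsubmx B) (usubmx C) (dsubmx C) => B1 B2 C1 C2.
move: (ulsubmx D) (ursubmx D) (dlsubmx D) (drsubmx D) => F D12 D21 D22 {B C D}.
set G := sD g; move=> [Xl Xr].
set Y := 1%:M + _.
(* The commutations [FY] and [YG] express both closed systems through [X]; [FGX] absorbs a direct
   path into the star. *)
have FY : F *m Y = X *m F.
  by rewrite [in RHS]Xl mulmxDr mulmx1 mulmxDl mul1mx !mulmxA.
have YG : Y *m G = G *m X.
  by rewrite [in RHS]Xr mulmxDr mulmx1 mulmxDl mul1mx !mulmxA.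
have FGX r s (L : 'M_(r, n)) (K : 'M_(n, s)) :
    L *m K + L *m F *m G *m X *m K = L *m X *m K.
  by rewrite [in RHS]Xl mulmxDr mulmx1 mulmxDl !mulmxA.
apply: sequivT (sclose_sequiv _ (scomp_tensidr _ _ _ _ _ _ _ _ _ _)) _.
apply: sequivT _ (sequivC (sclose_sequiv _ (scomp_tensidl _ _ _ _ _ _ _ _ _ _))).
rewrite !scloseE; mxblock.
rewrite !mulmxA -!(mulmxA _ Y G) YG -!(mulmxA _ F Y) FY !mulmxA.
(* What remains is that one side lists the states of [f] first and the other those of [g]; the block
   swap exchanges them. *)
apply: (@sequiv_iso _ _ _ _ (block_mx 0 1%:M 1%:M 0) (block_mx 0 1%:M 1%:M 0));
  mxblock; rewrite -?scalar_mx_block //.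
all: by rewrite ?FGX /Y ?(mulmxDr, mulmxDl) ?mulmx1 ?mulmxA.
Qed.

(** * Eliminating the wires one at a time *)

Lemma block_mx1A p n m (d : 'M[nat]_1) (e : 'M_(1, p)) (f : 'M_(p, 1)) (F : 'M_p)
    (e2 : 'M_(1, n)) (F12 : 'M_(p, n)) (f2 : 'M_(m, 1)) (F21 : 'M_(m, p)) F22 :
  block_mx (block_mx d e f F) (col_mx e2 F12) (row_mx f2 F21) F22 =
  block_mx d (row_mx e e2) (col_mx f f2) (block_mx F F12 F21 F22)
  :> 'M_(1 + (p + m), 1 + (p + n)).
Proof.
by rewrite block_mxA [X in (X, _)](eq_irrelevance _ erefl)
  [X in (_, X)](eq_irrelevance _ erefl) castmx_id.
Qed.

(** Positivity is what matters here: a nonzero natural number [d] would force [x >= 1 + x]. *)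
Lemma star_of_mx1 (d X : 'M[nat]_1) (Z : 'M_1) : X = 1%:M + (d *m X + Z) -> d = 0.
Proof.
move=> /matrixP /(_ 0 0); rewrite !mxE big_ord1 => X00.
apply/matrixP=> i j; rewrite !ord1 mxE.
case: (d 0 0) (X 0 0) (Z 0 0) X00 => // d' x z xE.
have {xE} xE : x = (1 + (d'.+1 * x + z))%N := xE.
by have := leqnn x; rewrite {1}xE add1n mulSn -!addnA ltnNge leq_addr.
Qed.

(** Gaussian elimination of the first wire. Once its loop [d] is known to vanish, the other wires
    see the links [F + f *m e], where [f *m e] collects the paths through the eliminated wire, and
    the star of these links determines all of [X]. *)
Lemma star_of_block p (d : 'M_1) (e : 'M_(1, p)) (f : 'M_(p, 1)) (F : 'M_p) X :
  star_of (block_mx d e f F) X ->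
  d = 0 /\ exists2 S, star_of (F + f *m e) S &
    X = block_mx (1%:M + e *m S *m f) (e *m S) (S *m f) S.
Proof.
rewrite -[X]submxK; move: (ulsubmx X) (ursubmx X) (dlsubmx X) (drsubmx X) => {X}.
move=> a b c s [].
rewrite (scalar_mx_block 1 p); mxblock.
move=> /eq_block_mx[aE bE cE sE] /eq_block_mx[aE' bE' cE' sE'].
have d0 : d = 0 by apply: star_of_mx1 aE.
move: aE bE cE sE aE' bE' cE' sE'; rewrite d0; mxblock.
move=> aE bE cE sE aE' bE' cE' sE'.
split=> //; exists s; last by rewrite -bE -cE' -aE'.
split; first by rewrite {1}sE bE mulmxDl mulmxA [in LHS](addrC (_ *m s)).
by rewrite {1}sE' cE' mulmxDr mulmxA [in LHS](addrC (_ *m e)).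
Qed.

Lemma star_of_blockK p (e : 'M_(1, p)) (f : 'M_(p, 1)) (F S : 'M_p) :
  star_of (F + f *m e) S ->
  star_of (block_mx 0 e f F)
    (block_mx (1%:M + e *m S *m f) (e *m S) (S *m f) S).
Proof.
move=> [Sl Sr]; split; rewrite (scalar_mx_block 1 p); mxblock.
  congr block_mx; rewrite ?mulmxA //.
    rewrite {1}Sl !(mulmxDl, mulmxDr) mul1mx mulmx1 !mulmxA -!addrA.
    by rewrite [in LHS](addrC (F *m _ *m _)).
  by rewrite {1}Sl mulmxDl ?mulmxA [in LHS](addrC (F *m _)).
congr block_mx; rewrite ?mulmxA //.
  rewrite {1}Sr !(mulmxDl, mulmxDr) mul1mx mulmx1 !mulmxA -!addrA.
  by rewrite [in LHS](addrC (_ *m F)).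
by rewrite {1}Sr mulmxDr ?mulmxA [in LHS](addrC (_ *m F)).
Qed.

(** Closing all the wires at once agrees with closing the first one, with star 1, and then the
    others with [S]: each path is sorted by its passages through the first wire. *)
Lemma sclose_block p n m k (A : 'M_k) (b : 'M_(k, 1)) (B1 : 'M_(k, p))
    (B2 : 'M_(k, n)) (c : 'M_(1, k)) (C1 : 'M_(p, k)) (C2 : 'M_(m, k))
    d (e : 'M_(1, p)) (f : 'M_(p, 1)) F e2 F12 f2 F21 F22 S :
  let B := row_mx (row_mx b B1) B2 in
  let C := col_mx (col_mx c C1) C2 in
  let D := block_mx (block_mx d e f F) (col_mx e2 F12) (row_mx f2 F21) F22 in
  let y := @sclose 1 (p + n) (p + m) (Sys A B C D) 1%:M in
  ulsubmx (sD y) = F + f *m e /\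
  sclose (Sys A B C D)
         (block_mx (1%:M + e *m S *m f) (e *m S) (S *m f) S) = sclose y S.
Proof.
move=> B C D y.
have -> : y = Sys (A + b *m c) (row_mx (B1 + b *m e) (B2 + b *m e2))
    (col_mx (C1 + f *m c) (C2 + f2 *m c))
    (block_mx (F + f *m e) (F12 + f *m e2) (F21 + f2 *m e) (F22 + f2 *m e2)).
  rewrite /y /B /C /D row_mx1A col_mx1A block_mx1A scloseE !mulmx1; mxblock.
  by [].
split; first by rewrite /= block_mxKul.
rewrite !scloseE; mxblock.
have expand r s (L0 : 'M_(r, s)) (l0 : 'M_(r, 1)) (l1 : 'M_(r, p)) (r0 : 'M_(1, s))
    (r1 : 'M_(p, s)) :
    L0 + ((l0 *m (1%:M + e *m S *m f) + l1 *m (S *m f)) *m r0 +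
          (l0 *m (e *m S) + l1 *m S) *m r1) =
    L0 + l0 *m r0 + (l1 + l0 *m e) *m S *m (r1 + f *m r0).
  rewrite !(mulmxDl, mulmxDr) mulmx1 !mulmxA -!addrA; congr (_ + (_ + _)).
  by rewrite [LHS]addrC [X in X + _ = _]addrC [X in X + _ + _ = _]addrC -!addrA.
by rewrite !expand.
Qed.

Lemma sys_ports1P p n m (P : sys (1 + p + n) (1 + p + m) -> Prop) :
  (forall k (A : 'M_k) b B1 B2 c C1 C2 d e f F e2 F12 f2 F21 D22,
     P (Sys A (row_mx (row_mx b B1) B2) (col_mx (col_mx c C1) C2)
          (block_mx (block_mx d e f F) (col_mx e2 F12) (row_mx f2 F21) D22))) ->
  forall x, P x.
Proof.
move=> hP; elim/sys_portsP=> k A B B2 C C2 D11 D12 D21 D22.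
rewrite -[B]hsubmxK -[C]vsubmxK -[D11]submxK -[D12]vsubmxK -[D21]hsubmxK.
exact: hP.
Qed.

(** Induction step for comparing a simultaneous closure with the iterated trace, which closes one
    wire at a time. *)
Lemma sclose_iter p n m (x : sys (1 + p + n) (1 + p + m)) X :
  star_of (ulsubmx (sD x)) X ->
  let y := @sclose 1 (p + n) (p + m) x 1%:M in
  @ulsubmx _ 1 (p + m) 1 (p + n) (sD x) = 0 /\
  exists2 S, star_of (ulsubmx (sD y)) S & sclose x X = sclose y S.
Proof.
elim/sys_ports1P: x => k A b B1 B2 c C1 C2 d e f F e2 F12 f2 F21 D22.
rewrite {1}/sD block_mxKul => /star_of_block[d0 [S SD ->]] y.
split; first by rewrite /sD block_mx1A block_mxKul.
have [yD yE] := sclose_block A b B1 B2 c C1 C2 d e f F e2 F12 f2 F21 D22 S.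
by exists S; rewrite ?yD ?yE.
Qed.

(** Converse of [sclose_iter] for the existence of stars: it makes the iterated trace fail whenever
    the whole set of wires has no star. *)
Lemma star_of_iter p n m (x : sys (1 + p + n) (1 + p + m)) S :
  @ulsubmx _ 1 (p + m) 1 (p + n) (sD x) = 0 ->
  star_of (ulsubmx (sD (@sclose 1 (p + n) (p + m) x 1%:M))) S ->
  exists X, star_of (ulsubmx (sD x)) X.
Proof.
elim/sys_ports1P: x => k A b B1 B2 c C1 C2 d e f F e2 F12 f2 F21 D22.
have [-> _] := sclose_block A b B1 B2 c C1 C2 d e f F e2 F12 f2 F21 D22 S.
move=> D0; have d0 : d = 0 by move: D0; rewrite /sD block_mx1A block_mxKul.
rewrite /sD block_mxKul d0 => /star_of_blockK starX.
by eexists; exact: starX.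
Qed.

(** * The traced prop of systems *)

(** Classical equality and choice structures, on which the generic quotient is built. *)
HB.instance Definition _ n m := gen_eqMixin (sys n m).
HB.instance Definition _ n m := gen_choiceMixin (sys n m).

Section Quotient.
Variables n m : nat.

Definition sequivb (x y : sys n m) : bool := `[< sequiv x y >].

Lemma sequivb_refl : reflexive sequivb.
Proof. by move=> x; apply/asboolP/sequivxx. Qed.

Lemma sequivb_sym : symmetric sequivb.
Proof. by move=> x y; apply/asboolP/asboolP; exact: sequivC. Qed.

Lemma sequivb_trans : transitive sequivb.
Proof.
by move=> y x z /asboolP xy /asboolP yz; apply/asboolP; exact: sequivT xy yz.
Qed.

Canonical sequiv_equiv := EquivRel sequivb sequivb_refl sequivb_sym sequivb_trans.

Definition qsys : Type := {eq_quot sequiv_equiv}.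

Definition qpi (x : sys n m) : qsys := \pi_{eq_quot sequiv_equiv} x.
Definition qrepr (q : qsys) : sys n m := repr (q : {eq_quot sequiv_equiv}).

Lemma qreprK q : qpi (qrepr q) = q.
Proof. exact: reprK. Qed.

Lemma qpiP x y : qpi x = qpi y <-> sequiv x y.
Proof.
split=> [xy|xy]; first by apply/asboolP/(eqmodP sequiv_equiv).
by apply/(eqmodP sequiv_equiv)/asboolP.
Qed.

Lemma qrepr_sequiv x : sequiv (qrepr (qpi x)) x.
Proof. by apply/qpiP; rewrite qreprK. Qed.

Lemma qsysW (P : qsys -> Prop) : (forall x, P (qpi x)) -> forall q, P q.
Proof. by move=> hP q; rewrite -[q]qreprK. Qed.

End Quotient.

(* [None] is the absorbing morphism produced by instantaneous cycles. *)
Definition qhom n m : Type := option (qsys n m).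

Definition qsome n m (x : sys n m) : qhom n m := Some (qpi x).

Lemma qhomW n m (P : qhom n m -> Prop) :
  P None -> (forall x, P (qsome x)) -> forall f, P f.
Proof. by move=> P0 PS [q|//]; elim/qsysW: q => x; exact: PS. Qed.

Lemma qsomeP n m (x y : sys n m) : qsome x = qsome y <-> sequiv x y.
Proof.
by split=> [[/qpiP]|xy] //; congr Some; apply/qpiP.
Qed.

Definition qcomp n m k (g : qhom m k) (f : qhom n m) : qhom n k :=
  if g is Some y then if f is Some x then qsome (scomp (qrepr y) (qrepr x))
  else None else None.

Definition qtens n m n' m' (f : qhom n m) (g : qhom n' m') :
    qhom (n + n') (m + m') :=
  if f is Some x then if g is Some y then qsome (stens (qrepr x) (qrepr y))
  else None else None.

(** For one wire over nat a star exists exactly when the link is 0, and it is then 1. By [sequiv_sD]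
    the test does not depend on the representative. *)
Definition qtr n m (f : qhom (1 + n) (1 + m)) : qhom n m :=
  if f is Some q then
    if @ulsubmx _ 1 m 1 n (sD (qrepr q)) == 0
    then qsome (sclose (qrepr q) (1%:M : 'M_1)) else None
  else None.

Lemma qcompE n m k (y : sys m k) (x : sys n m) :
  qcomp (qsome y) (qsome x) = qsome (scomp y x).
Proof. by apply/qsomeP/scomp_sequiv; exact: qrepr_sequiv. Qed.

Lemma qcompN n m k (g : qhom m k) : qcomp g (None : qhom n m) = None.
Proof. by case: g. Qed.

Lemma qtensE n m n' m' (x : sys n m) (y : sys n' m') :
  qtens (qsome x) (qsome y) = qsome (stens x y).
Proof. by apply/qsomeP/stens_sequiv; exact: qrepr_sequiv. Qed.

Lemma qtensN n m n' m' (f : qhom n m) : qtens f (None : qhom n' m') = None.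
Proof. by case: f. Qed.

Lemma qtrE n m (x : sys (1 + n) (1 + m)) :
  qtr (qsome x) = if @ulsubmx _ 1 m 1 n (sD x) == 0
                  then qsome (sclose x (1%:M : 'M_1)) else None.
Proof.
rewrite /qtr /qsome (sequiv_sD (qrepr_sequiv x)); case: ifP => // _.
by apply/qsomeP/sclose_sequiv; exact: qrepr_sequiv.
Qed.

Lemma hcast_qsome n m n' m' (en : n = n') (em : m = m') (x : sys n m) :
  hcast en em (qsome x) = qsome (scast en em x).
Proof. by case: n' / en; case: m' / em; rewrite -hcast_sys. Qed.

Lemma hcast_None n m n' m' (en : n = n') (em : m = m') :
  hcast en em (None : qhom n m) = None.
Proof. by case: n' / en; case: m' / em. Qed.

Definition qemb n m (A : 'M[nat]_(m, n)) : qhom n m := qsome (semb A).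

Lemma qcomp1f n m (f : qhom n m) : qcomp (qemb 1%:M) f = f.
Proof. by elim/qhomW: f => [//|x]; rewrite qcompE scomp1s. Qed.

Lemma qcompf1 n m (f : qhom n m) : qcomp f (qemb 1%:M) = f.
Proof. by elim/qhomW: f => [//|x]; rewrite qcompE; apply/qsomeP/scomps1. Qed.

Lemma qcompA n m k l (h : qhom k l) (g : qhom m k) (f : qhom n m) :
  qcomp h (qcomp g f) = qcomp (qcomp h g) f.
Proof.
elim/qhomW: h => [//|z]; elim/qhomW: g => [//|y].
elim/qhomW: f => [|x]; first by rewrite !qcompN.
by rewrite !qcompE; apply/qsomeP/scompA.
Qed.

Lemma qemb_comp n m k (B : 'M_(k, m)) (A : 'M_(m, n)) :
  qcomp (qemb B) (qemb A) = qemb (B *m A).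
Proof. by rewrite qcompE scomp_semb. Qed.

Lemma qemb_tens n m n' m' (A : 'M_(m, n)) (B : 'M_(m', n')) :
  qtens (qemb A) (qemb B) = qemb (block_mx A 0 0 B).
Proof. by rewrite qtensE stens_semb. Qed.

Lemma hcast_qemb n m n' m' (en : n = n') (em : m = m') (A : 'M_(m, n)) :
  hcast en em (qemb A) = qemb (castmx (em, en) A).
Proof. by rewrite hcast_qsome scast_semb. Qed.

Lemma qtens_id n m : qtens (qemb 1%:M) (qemb 1%:M) = qemb (1%:M : 'M_(n + m)).
Proof. by rewrite qemb_tens -scalar_mx_block. Qed.

Lemma qtens_comp n m k n' m' k' (g : qhom m k) (f : qhom n m)
    (g' : qhom m' k') (f' : qhom n' m') :
  qtens (qcomp g f) (qcomp g' f') = qcomp (qtens g g') (qtens f f').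
Proof.
elim/qhomW: g => [//|y]; elim/qhomW: f => [|x]; first by rewrite !qcompN.
elim/qhomW: g' => [|y']; first by rewrite !qtensN.
elim/qhomW: f' => [|x']; first by rewrite !(qcompN, qtensN).
by rewrite !(qcompE, qtensE); apply/qsomeP/stens_comp.
Qed.

Lemma qtens0f n m (f : qhom n m) : qtens (qemb (1%:M : 'M_0)) f = f.
Proof. by elim/qhomW: f => [//|x]; rewrite qtensE stens0s. Qed.

Lemma qtensf0 n m (f : qhom n m) :
  hcast (addn0 n) (addn0 m) (qtens f (qemb (1%:M : 'M_0))) = f.
Proof.
elim/qhomW: f => [|x]; first by rewrite hcast_None.
by rewrite qtensE hcast_qsome; apply/qsomeP/stenss0.
Qed.

Lemma qtensA n m n' m' n'' m'' (f : qhom n m) (g : qhom n' m') (h : qhom n'' m'') :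
  hcast (addnA n n' n'') (addnA m m' m'') (qtens f (qtens g h))
  = qtens (qtens f g) h.
Proof.
elim/qhomW: f => [|x]; first by rewrite hcast_None.
elim/qhomW: g => [|y]; first by rewrite qtensN hcast_None.
elim/qhomW: h => [|z]; first by rewrite !qtensN hcast_None.
by rewrite !qtensE hcast_qsome; apply/qsomeP/stensA.
Qed.

Definition qsym m n : qhom (m + n) (n + m) := qemb (msym nat m n).

Lemma qsym_nat n m n' m' (f : qhom n m) (g : qhom n' m') :
  qcomp (qsym m m') (qtens f g) = qcomp (qtens g f) (qsym n n').
Proof.
elim/qhomW: f => [|x]; first by rewrite qtensN.
elim/qhomW: g => [|y]; first by rewrite qtensN.
by rewrite !qtensE !qcompE; apply/qsomeP/ssym_nat.
Qed.

Lemma qsymK m n : qcomp (qsym n m) (qsym m n) = qemb 1%:M.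
Proof. by rewrite qemb_comp -[RHS]/(qemb (mid nat _)) -msymK. Qed.

Lemma qsym0 n : hcast (addn0 n) (erefl n) (qsym n 0) = qemb 1%:M.
Proof. by rewrite hcast_qemb -hcast_mx msym0. Qed.

Lemma qsym_hexagon m n p :
  hcast (erefl (m + (n + p))%N) (esym (addnA n p m)) (qsym m (n + p))
  = qcomp (qtens (qemb 1%:M) (qsym m p))
          (hcast (esym (addnA m n p)) (esym (addnA n m p))
                 (qtens (qsym m n) (qemb 1%:M))).
Proof.
rewrite !qemb_tens !hcast_qemb qemb_comp -!hcast_mx msym_hexagon.
by rewrite /mcomp /mtens hcast_mx.
Qed.

Definition qprop : prop :=
  Prop_ qcomp1f qcompf1 qcompA qtens_id qtens_comp qtens0f qtensf0 qtensA
        qsym_nat qsymK qsym0 qsym_hexagon.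

(** * The iterated trace and the trace axioms *)

Lemma tr_iter_None p n m : tr_iter qtr (None : qhom (p + n) (p + m)) = None.
Proof. by elim: p. Qed.

Lemma tr_iterS p n m (x : sys (p.+1 + n) (p.+1 + m)) :
  tr_iter qtr (qsome x) =
  tr_iter qtr (p := p) (qtr (qsome (x : sys (1 + (p + n)) (1 + (p + m))))).
Proof. by []. Qed.

Lemma rsubmx0l k n (B : 'M[nat]_(k, 0 + n)) : rsubmx B = B.
Proof. by apply/matrixP=> i j; rewrite mxE; congr (B i _); apply: val_inj. Qed.

Lemma dsubmx0l k n (B : 'M[nat]_(0 + n, k)) : dsubmx B = B.
Proof. by apply/matrixP=> i j; rewrite mxE; congr (B _ j); apply: val_inj. Qed.

(** Together with [qtr_iterN] this describes the iterated trace completely: a simultaneous closure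
    if a star exists, [None] otherwise. *)
Lemma qtr_iterE p n m (x : sys (p + n) (p + m)) X :
  star_of (ulsubmx (sD x)) X -> tr_iter qtr (qsome x) = qsome (sclose x X).
Proof.
elim: p x X => [|p IHp] x X starX.
  congr qsome; rewrite /sclose (mx0c (lsubmx _) 0) (mx0c (dlsubmx _) 0).
  rewrite !mul0mx !addr0 rsubmx0l dsubmx0l /drsubmx rsubmx0l dsubmx0l.
  by case: (x).
have [D0 [S starS ->]] := sclose_iter starX.
by rewrite tr_iterS qtrE D0 eqxx; exact: IHp starS.
Qed.

Lemma qtr_iterN p n m (x : sys (p + n) (p + m)) :
  (forall X, ~ star_of (ulsubmx (sD x)) X) -> tr_iter qtr (qsome x) = None.
Proof.
elim: p x => [|p IHp] x noX.
  (* The empty matrix has a star, so the hypothesis is contradictory here. *)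
  by case: (noX 1%:M); split; exact: mx0r.
rewrite tr_iterS qtrE; case: eqP => [D0|_]; last exact: tr_iter_None.
apply: IHp => S starS; have [X starX] := star_of_iter D0 starS.
exact: noX starX.
Qed.

Lemma qtr_tightening n m n' m' (g : qhom m m') (f : qhom (1 + n) (1 + m))
    (h : qhom n' n) :
  qtr (qcomp (qtens (qemb (1%:M : 'M_1)) g)
             (qcomp f (qtens (qemb (1%:M : 'M_1)) h)))
  = qcomp g (qcomp (qtr f) h).
Proof.
elim/qhomW: g => [|y]; first by rewrite qtensN.
elim/qhomW: f => [|x]; first by rewrite !qcompN.
elim/qhomW: h => [|z]; first by rewrite qtensN !qcompN.
rewrite /qemb !qtensE !qcompE !qtrE sclose_tightening.
suff -> : @ulsubmx _ 1 m' 1 n' (sD (scomp (stens (semb 1%:M) y)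
    (scomp x (stens (semb 1%:M) z)))) = ulsubmx (sD x).
  by case: ifP => //; rewrite !qcompE.
elim/sys_portsP: x => k A B1 B2 C1 C2 D11 D12 D21 D22.
by rewrite scomp_idtensr scomp_idtensl /sD !block_mxKul.
Qed.

Lemma qtr_yanking : qtr (qsym 1 1) = qemb 1%:M.
Proof.
rewrite qtrE /= block_mxKul eqxx; congr qsome; rewrite /sclose /=.
rewrite block_mxKur block_mxKdl block_mxKdr !mulmx1 !add0r.
exact: sys0E.
Qed.

Lemma qtr_sliding m n p q (f : qhom (m + p) (n + q)) (g : qhom n m) :
  tr_iter qtr (p := n) (qcomp f (qtens g (qemb 1%:M)))
  = tr_iter qtr (p := m) (qcomp (qtens g (qemb 1%:M)) f).
Proof.
elim/qhomW: f => [|x]; first by rewrite !qcompN !tr_iter_None.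
elim/qhomW: g => [|y].
  by apply: etrans (tr_iter_None n p q) _; rewrite tr_iter_None.
rewrite /qemb !qtensE !qcompE.
have [[X starX]|noX] := pselect (exists X, star_of (ulsubmx (sD x) *m sD y) X).
  rewrite (qtr_iterE (X := X)); last first.
    by rewrite /= -[sD x]submxK; mxblock; rewrite !block_mxKul.
  rewrite (qtr_iterE (X := 1%:M + sD y *m X *m ulsubmx (sD x))); last first.
    rewrite /= -[sD x]submxK; mxblock; rewrite !block_mxKul. exact: star_slide.
  exact/qsomeP/sclose_sliding.
(* By [star_slide] the products of the two link matrices in either order have stars together, so
   both sides are [None] together. *)
rewrite !qtr_iterN // => X starX; apply: noX.
  move: starX; rewrite /= -[sD x]submxK; mxblock; rewrite !block_mxKul.
  by move=> /star_slide starY; eexists; exact: starY.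
move: starX; rewrite /= -[sD x]submxK; mxblock; rewrite !block_mxKul.
by exists X.
Qed.

Lemma qtr_strength n m n' m' (f : qhom (1 + n) (1 + m)) (g : qhom n' m') :
  qtr (qtens f g : qhom (1 + (n + n')) (1 + (m + m'))) = qtens (qtr f) g.
Proof.
elim/qhomW: f => [//|x]; elim/qhomW: g => [|y]; first by rewrite !qtensN.
rewrite qtensE !qtrE sclose_strength.
suff -> : @ulsubmx _ 1 (m + m') 1 (n + n') (sD (stens x y)) = ulsubmx (sD x).
  by case: ifP => //; rewrite !qtensE.
elim/sys_portsP: x => k A B1 B2 C1 C2 D11 D12 D21 D22.
by rewrite stens1E /sD !block_mxKul.
Qed.

Definition qtraced : traced_prop :=
  @TracedProp qprop qtr qtr_tightening qtr_yanking qtr_sliding qtr_strength.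

(** * Polynomial matrices as systems *)

(* Coefficientwise, [delay D x] is D + t x, and [advance x] divides by t the
   response of [x] minus its constant term. *)
Definition delay n m (D : 'M[nat]_(m, n)) (x : sys n m) : sys n m :=
  Sys (block_mx (sA x) (sB x) 0 0) (col_mx 0 1%:M) (row_mx (sC x) (sD x)) D.

Definition advance n m (x : sys n m) : sys n m :=
  Sys (sA x) (sB x) (sC x *m sA x) (sC x *m sB x).

(** The Markov parameters D, CB, CAB, CAAB, ..., that is, the coefficients of the transfer function
    D + t C (1 - tA)^-1 B. *)
Definition markov n m (x : sys n m) (i : nat) : 'M[nat]_(m, n) :=
  sD (iter i (@advance n m) x).

(** Horner's scheme for f(0) + t f(1) + ... + t^d f(d), each multiplication by t being a delay. *)
Fixpoint realize n m (d : nat) (f : nat -> 'M[nat]_(m, n)) : sys n m :=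
  if d is d'.+1 then delay (f 0) (realize d' (fun i => f i.+1))
  else semb (f 0).

(* A triangular form of nilpotency, stable under composition of systems; it
   lets unobserved states be removed one at a time. *)
Definition strict_upper k (A : 'M[nat]_k) : Prop :=
  forall i j : 'I_k, (j <= i)%N -> A i j = 0.

Lemma markovS n m (x : sys n m) i : markov x i.+1 = markov (advance x) i.
Proof. by rewrite /markov iterSr. Qed.

(** * Strictly triangular systems are determined by their impulse response *)

Section Realization.
Variables n m : nat.
Implicit Types (x y : sys n m) (f : nat -> 'M[nat]_(m, n)).

Lemma delay_advance x : sequiv (delay (sD x) (advance x)) x.
Proof.
case: x => k A B C D; apply: sequiv_step.
(* The delayed system stores the last state and the last input; [g] performs the update A x + B u on
   them. *)
exists (row_mx A B), (col_mx 1%:M 0).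
by split=> //=; mxblock.
Qed.

Lemma delay_sequiv D x y : sequiv x y -> sequiv (delay D x) (delay D y).
Proof.
apply: sequiv_map => {x y}.
case=> [k1 A1 B1 C1 D1] [k2 A2 B2 C2 D2] [/= g [h [/= <- <- <- <- ->]]].
exists (block_mx g 0 0 1%:M), (block_mx h B1 0 0).
by split=> //=; mxblock.
Qed.

Lemma strict_upper_block k l (A : 'M_k) (B : 'M_(k, l)) (D : 'M_l) :
  strict_upper A -> strict_upper D -> strict_upper (block_mx A B 0 D).
Proof.
move=> hA hD i j; rewrite -[i]splitK -[j]splitK.
case: split => i'; case: split => j' /=.
- by rewrite block_mxEul; exact: hA.
- by rewrite block_mxEdl mxE.
- by rewrite leqNgt ltn_addr.
- by rewrite block_mxEdr leq_add2l; exact: hD.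
Qed.

Lemma sequiv_drop_unobserved k l (Z : 'M_(l, k)) (A : 'M_k) (B' : 'M_(l, n))
    (B : 'M_(k, n)) (C : 'M_(m, k)) D :
  sequiv (Sys (block_mx 0 Z 0 A) (col_mx B' B) (row_mx 0 C) D) (Sys A B C D).
Proof.
apply: sequiv_step; exists (row_mx 0 1%:M : 'M_(k, l + k)), (col_mx Z A).
by split=> //=; mxblock.
Qed.

Lemma sequiv_unobserved k (A : 'M_k) (B : 'M_(k, n)) (D : 'M_(m, n)) :
  strict_upper A -> sequiv (Sys A B 0 D) (semb D).
Proof.
elim: k A B => [|k IHk]; first by move=> A B _; rewrite sys0E; exact: sequivxx.
suff IH (A : 'M_(1 + k)) (B : 'M_(1 + k, n)) :
  strict_upper A -> sequiv (Sys A B 0 D) (semb D) by exact: IH.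
move=> hA; have hA' : strict_upper (drsubmx A).
  by move=> i j ij; rewrite !mxE; apply: hA.
apply: sequivT (IHk _ (dsubmx B) hA').
have A1 : ulsubmx A = 0.
  by apply/matrixP=> i j; rewrite !mxE; apply: hA; rewrite !ord1.
have A3 : dlsubmx A = 0.
  by apply/matrixP=> i j; rewrite !mxE; apply: hA; rewrite !ord1.
rewrite -[in Sys A _ _ _](submxK A) -[in Sys _ B _ _](vsubmxK B) A1 A3 -row_mx0.
exact: sequiv_drop_unobserved.
Qed.

(** Advancing leaves [sA] and [sB] alone and multiplies the output map by [sA x]. Strict
    triangularity clears one more column each time, so the output map vanishes after [sdim x]
    rounds. *)
Lemma sA_iter_advance x i : exists2 CD : 'M_(m, sdim x) * 'M_(m, n),
  iter i (@advance n m) x = Sys (sA x) (sB x) CD.1 CD.2 &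
  strict_upper (sA x) -> forall r (j : 'I_(sdim x)), (j < i)%N -> CD.1 r j = 0.
Proof.
elim: i => [|i [[C D] /= xE C0]].
  by exists (sC x, sD x) => //; case: (x).
exists (C *m sA x, C *m sB x); first by rewrite xE.
move=> hA r j ji; rewrite mxE big1 // => l _.
have [jl|lj] := leqP j l; first by rewrite hA // mulr0.
by rewrite C0 ?mul0r // (leq_trans lj).
Qed.

Lemma realize_eq f f' d : f =1 f' -> realize d f = realize d f'.
Proof.
elim: d f f' => [|d IHd] f f' ff' /=; first by rewrite ff'.
by rewrite ff' (IHd _ (fun i => f' i.+1)).
Qed.

Lemma sequiv_realize x d : strict_upper (sA x) -> (sdim x <= d)%N ->
  sequiv x (realize d (markov x)).
Proof.
move=> hA dx; have [[C D] /= xE C0] := sA_iter_advance x d.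
(* The dimension bound is traded for this equation: advancing keeps the dimension, but it uses up
   one of the [d] rounds, as the induction requires. *)
have {C0 D xE dx} : sC (iter d (@advance n m) x) = 0.
  rewrite xE; apply/matrixP=> r j; rewrite mxE C0 //.
  exact: leq_trans (ltn_ord j) dx.
elim: d x hA {C} => [|d IHd] x hA.
  by case: x hA => k A B C D /= hA ->; exact: sequiv_unobserved.
rewrite iterSr => Cd; apply: sequivT (sequivC (delay_advance x)) _.
apply: sequivT (delay_sequiv _ (IHd (advance x) hA Cd)) _ => /=.
rewrite (realize_eq _ (fun i => esym (markovS x i))); exact: sequivxx.
Qed.

Lemma strict_upper_realize d f : strict_upper (sA (realize d f)).
Proof.
elim: d f => [|d IHd] f /=; first by move=> [].
by apply: strict_upper_block => [|i j _]; rewrite ?mxE.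
Qed.

(** A delay commutes with advancing except for the direct link, which becomes the parameter just
    released by [x]; the initial [D] is gone after one round, hence [i.+1]. *)
Lemma iter_advance_delay D x i :
  iter i.+1 (@advance n m) (delay D x) =
  delay (markov x i) (iter i.+1 (@advance n m) x).
Proof.
elim: i => [|i IHi]; first by rewrite /advance /delay /=; mxblock.
by rewrite iterS IHi {1}/advance /delay /=; mxblock.
Qed.

Lemma markov_delay D x i : markov (delay D x) i.+1 = markov x i.
Proof. by rewrite /markov iter_advance_delay. Qed.

Lemma markov_unobserved k (A : 'M_k) (B : 'M_(k, n)) (D : 'M_(m, n)) i :
  markov (Sys A B 0 D) i = if i is 0 then D else 0.
Proof.
elim: i D => // i IHi D; rewrite markovS /advance /= !mul0mx IHi.
by case: i {IHi}.
Qed.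

Lemma markov_realize d f i : markov (realize d f) i = if (i <= d)%N then f i else 0.
Proof.
elim: d f i => [|d IHd] f [|i] //=; first by rewrite markov_unobserved.
by rewrite markov_delay IHd.
Qed.

(** Both systems reduce to the realization of their common response, up to a degree that bounds both
    dimensions. *)
Lemma sequiv_markov x y : strict_upper (sA x) -> strict_upper (sA y) ->
  markov x =1 markov y -> sequiv x y.
Proof.
move=> hx hy xy.
apply: sequivT (sequiv_realize hx (leq_maxl (sdim x) (sdim y))) _.
rewrite (realize_eq _ xy); apply: sequivC.
exact: sequiv_realize hy (leq_maxr _ _).
Qed.

End Realization.

Lemma markov_tens n m n' m' (x : sys n m) (y : sys n' m') i :
  markov (stens x y) i = block_mx (markov x i) 0 0 (markov y i).
Proof.
rewrite /markov; suff -> : iter i (@advance _ _) (stens x y) =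
  stens (iter i (@advance n m) x) (iter i (@advance n' m') y) by [].
by elim: i => //= i ->; rewrite /advance /stens /=; mxblock.
Qed.

Lemma markov_add n m k (A : 'M_k) (B : 'M_(k, n)) (C C' : 'M_(m, k)) D D' i :
  markov (Sys A B (C + C') (D + D')) i =
  markov (Sys A B C D) i + markov (Sys A B C' D') i.
Proof.
elim: i C C' D D' => [//|i IHi] C C' D D'.
by rewrite !markovS /advance /= !mulmxDl IHi.
Qed.

Lemma markov_mull n m m' k (L : 'M_(m', m)) (A : 'M_k) (B : 'M_(k, n)) C D i :
  markov (Sys A B (L *m C) (L *m D)) i = L *m markov (Sys A B C D) i.
Proof.
elim: i C D => [//|i IHi] C D.
by rewrite !markovS /advance /= -!mulmxA IHi.
Qed.

Lemma markov_drop n m k l (A : 'M_k) (Z : 'M_(k, l)) (A' : 'M_l) (B : 'M_(k, n))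
    (B' : 'M_(l, n)) (C : 'M_(m, l)) D i :
  markov (Sys (block_mx A Z 0 A') (col_mx B B') (row_mx 0 C) D) i =
  markov (Sys A' B' C D) i.
Proof.
elim: i C D => [//|i IHi] C D.
by rewrite !markovS /advance /=; mxblock.
Qed.

Lemma markov_comp n m k (y : sys m k) (x : sys n m) i :
  markov (scomp y x) i = \sum_(j < i.+1) markov y j *m markov x (i - j).
Proof.
elim: i y => [|i IHi] y; first by rewrite big_ord1.
rewrite big_ord_recl /= subn0; under eq_bigr do rewrite /bump add1n subSS markovS.
rewrite -IHi [in LHS]markovS.
rewrite (markovS x).
(* Writing y0 and x0 for the constant terms, this is (yx - y0 x0)/t = y0 (x - x0)/t + ((y - y0)/t)
   x, the recursion behind the Cauchy product. *)
have -> : advance (scomp y x) = Sys (sA (scomp y x)) (sB (scomp y x))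
    (row_mx 0 (sD y *m (sC x *m sA x)) + sC (scomp (advance y) x))
    (sD y *m (sC x *m sB x) + sD (scomp (advance y) x)).
  by rewrite /advance /=; mxblock; rewrite !mulmxA; congr Sys; rewrite addrC.
by rewrite markov_add; congr (_ + _); rewrite markov_drop markov_mull.
Qed.

(** * Coefficients of polynomial matrices and the interpretation functor *)

Definition mcoef n m (P : 'M[{poly nat}]_(m, n)) (i : nat) : 'M[nat]_(m, n) :=
  map_mx (coefp i) P.

Definition mxsize n m (P : 'M[{poly nat}]_(m, n)) : nat :=
  (\max_i \max_j size (P i j))%N.

Lemma mcoef_big n m i (P : 'M[{poly nat}]_(m, n)) :
  (mxsize P <= i)%N -> mcoef P i = 0.
Proof.
move=> Pi; apply/matrixP=> r c; rewrite !mxE /= nth_default //.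
apply: leq_trans Pi; rewrite /mxsize.
by apply: leq_trans (leq_bigmax r); exact: (leq_bigmax c).
Qed.

Lemma mcoef_mul n m k i (Q : 'M[{poly nat}]_(k, m)) (P : 'M_(m, n)) :
  mcoef (Q *m P) i = \sum_(j < i.+1) mcoef Q j *m mcoef P (i - j).
Proof.
apply/matrixP=> r c; rewrite summxE !mxE raddf_sum /=.
under [RHS]eq_bigr do rewrite mxE.
rewrite exchange_big /=; apply: eq_bigr => l _; rewrite coefM.
by apply: eq_bigr => j _; rewrite !mxE.
Qed.

Definition interp n m (P : 'M[{poly nat}]_(m, n)) : qhom n m :=
  qsome (realize (mxsize P) (mcoef P)).

(** Any strictly triangular system with the right response may replace the chosen realization, so
    the functor laws become identities between coefficients. *)
Lemma interp_eq n m (P : 'M[{poly nat}]_(m, n)) (x : sys n m) :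
  strict_upper (sA x) -> markov x =1 mcoef P -> interp P = qsome x.
Proof.
move=> hx xP; apply/qsomeP/sequiv_markov => // [|i].
  exact: strict_upper_realize.
rewrite markov_realize xP; case: leqP => // /ltnW.
by move/mcoef_big.
Qed.

Lemma interp_markov n m (P : 'M[{poly nat}]_(m, n)) :
  markov (realize (mxsize P) (mcoef P)) =1 mcoef P.
Proof.
by move=> i; rewrite markov_realize; case: leqP => // /ltnW /mcoef_big.
Qed.

Lemma interp_const n m (A : 'M[nat]_(m, n)) : interp (map_mx polyC A) = qemb A.
Proof.
apply: interp_eq => [[]//|i]; rewrite markov_unobserved.
by apply/matrixP=> r c; case: i => [|i]; rewrite !mxE /= coefC.
Qed.

Lemma interp_id n : interp (1%:M : 'M_n) = qemb 1%:M.
Proof. by rewrite -interp_const map_scalar_mx. Qed.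

Lemma interp_comp n m k (Q : 'M_(k, m)) (P : 'M_(m, n)) :
  interp (Q *m P) = qcomp (interp Q) (interp P).
Proof.
rewrite qcompE; apply: interp_eq => [|i].
  by apply: strict_upper_block; exact: strict_upper_realize.
rewrite markov_comp mcoef_mul; apply: eq_bigr => j _.
by rewrite !interp_markov.
Qed.

Lemma interp_tens n m n' m' (P : 'M_(m, n)) (Q : 'M_(m', n')) :
  interp (block_mx P 0 0 Q) = qtens (interp P) (interp Q).
Proof.
rewrite qtensE; apply: interp_eq => [|i].
  by apply: strict_upper_block; exact: strict_upper_realize.
by rewrite markov_tens !interp_markov /mcoef map_block_mx !map_mx0.
Qed.

Lemma interp_sym m n : interp (msym {poly nat} m n) = qsym m n.
Proof.
by rewrite /qsym -interp_const /msym map_block_mx !map_mx0 !map_scalar_mx.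
Qed.

Definition interp_functor : prop_functor polymx_prop qtraced :=
  @PropFunctor polymx_prop qtraced interp
    interp_id interp_comp interp_tens interp_sym.

(** * Closed morphisms *)

Lemma hcast_comp (P : prop) n n' m m' k k' (en : n = n') (em : m = m')
    (ek : k = k') (g : Defs.hom P m k) (f : Defs.hom P n m) :
  Defs.pcomp (hcast em ek g) (hcast en em f) = hcast en ek (Defs.pcomp g f).
Proof. by case: n' / en; case: m' / em; case: k' / ek. Qed.

Lemma fmap_hcast (P Q : prop) (F : prop_functor P Q) n n' m m' (en : n = n')
    (em : m = m') (f : Defs.hom P n m) :
  fmap F (hcast en em f) = hcast en em (fmap F f).
Proof. by case: n' / en; case: m' / em. Qed.

Lemma fmap_trn (P Q : traced_prop) (F : traced_functor P Q) p n m
    (f : Defs.hom P (p + n) (p + m)) :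
  fmap F (trn p f) = trn p (fmap F f).
Proof.
rewrite /trn; elim: p f => [//|p IHp] f.
by rewrite /= IHp -(fmap_tr F).
Qed.

Lemma hcastK (P : prop) n n' m m' (en : n = n') (em : m = m') (f : Defs.hom P n m)
    (f' : Defs.hom P n' m') :
  hcast en em f = f' -> f = hcast (esym en) (esym em) f'.
Proof. by case: n' / en f'; case: m' / em => f' <-. Qed.

Lemma tilde_comm (P : traced_prop) (iota : prop_functor polymx_prop P) n m
    (A : 'M[{poly nat}]_(n, m)) (B : 'M_(m, n)) :
  tilde iota (A *m B) = tilde iota (B *m A).
Proof.
rewrite /tilde.
have -> : fmap iota (A *m B : Defs.hom polymx_prop n n) =
  Defs.pcomp (fmap iota (A : Defs.hom polymx_prop m n))
             (fmap iota (B : Defs.hom polymx_prop n m)).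
  exact: (fmap_comp iota A B).
have -> : fmap iota (B *m A : Defs.hom polymx_prop m m) =
  Defs.pcomp (fmap iota (B : Defs.hom polymx_prop n m))
             (fmap iota (A : Defs.hom polymx_prop m n)).
  exact: (fmap_comp iota B A).
set f := fmap iota A; set g := fmap iota B.
(* With p = q = 0 the axiom involves [g] tensored with the identity of 0, which [tensp0] turns into
   a transported [g]. *)
have slide := tr_sliding (p := 0) (q := 0)
  (hcast (esym (addn0 m)) (esym (addn0 n)) f) g.
move: slide; rewrite (hcastK (tensp0 g)) !hcast_comp.
exact.
Qed.

Lemma tmx_mul n m (A : 'M[nat]_(n, m)) (B : 'M_(m, n)) :
  tmx (A *m B) = ('X *: map_mx polyC A) *m map_mx polyC B.
Proof. by rewrite /tmx map_mxM -scalemxAl. Qed.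

Lemma tilde_sse (P : traced_prop) (iota : prop_functor polymx_prop P) m n
    (M : 'M_m) (N : 'M_n) :
  sse M N -> tilde iota (tmx M) = tilde iota (tmx N).
Proof.
elim=> {m n M N} [m n R S|//|m n M N _ ->//|m n p M N L _ -> _ ->//].
(* The indeterminate travels with [R]; once the factors are exchanged it is pulled out of the
   product on the right. *)
rewrite tmx_mul tilde_comm; congr (tilde iota _).
by rewrite /tmx map_mxM scalemxAr.
Qed.

Lemma sequiv_sse (x y : sys 0 0) : sequiv x y -> sse (sA x) (sA y).
Proof.
elim=> {x y} [x y [g [h [<- <- _ _ _]]]|x|x y _|x y z _ xy _ yz].
- exact: sse_mul.
- exact: sse_refl.
- exact: sse_sym.
- exact: sse_trans xy yz.
Qed.

(** The system holds its input for one step and then applies [M], so its response is 0, [M], 0, 0,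
    .... *)
Lemma interp_tmx n (M : 'M_n) : interp (tmx M) = qsome (Sys 0 1%:M M 0).
Proof.
apply: interp_eq => [i j _|]; first by rewrite mxE.
case=> [|i]; first by apply/matrixP=> r c; rewrite !mxE /= coefXM.
rewrite markovS /advance /= mulmx0 mulmx1 markov_unobserved.
by apply/matrixP=> r c; case: i => [|i]; rewrite !mxE /= coefXM coefC.
Qed.

Lemma lsubmx_cast0 k n (B : 'M[nat]_(k, n)) :
  lsubmx (castmx (erefl k, esym (addn0 n)) B) = B.
Proof.
by rewrite -[in LHS](castmx_row_mx0 B) castmx_comp castmx_id row_mxKl.
Qed.

Lemma usubmx_cast0 k n (B : 'M[nat]_(n, k)) :
  usubmx (castmx (esym (addn0 n), erefl k) B) = B.
Proof.
by rewrite -[in LHS](castmx_col_mx0 B) castmx_comp castmx_id col_mxKu.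
Qed.

Lemma ulsubmx_cast0 k n (e : (k = k + 0)%N) (e' : (n = n + 0)%N) :
  ulsubmx (castmx (e, e') (0 : 'M[nat]_(k, n))) = 0.
Proof. by apply/matrixP=> i j; rewrite !mxE castmxE mxE. Qed.

(** There is no instantaneous link, so the star is 1, and feeding the output [M] of the state back
    into its input makes [M] the transition matrix. *)
Lemma tilde_interp n (M : 'M_n) :
  tilde interp_functor (tmx M) = qsome (Sys M 0 0 0 : sys 0 0).
Proof.
rewrite /tilde /trn /= interp_tmx hcast_qsome (qtr_iterE (X := 1%:M)).
  congr qsome; rewrite /sclose /scast /= lsubmx_cast0 usubmx_cast0.
  rewrite mulmx1 mul1mx add0r.
  by rewrite (mx0c (_ + _) 0) (mx0r (dsubmx _ + _) 0) (mx0r (drsubmx _ + _) 0).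
by rewrite /= ulsubmx_cast0; split; rewrite ?mul0mx ?mulmx0 addr0.
Qed.

Theorem theorem2 (Mhat : traced_prop) (iota : prop_functor polymx_prop Mhat)
    (hiota : is_traced_completion iota)
    (m n : nat) (M : 'M[nat]_m) (N : 'M[nat]_n) :
  tilde iota (tmx M) = tilde iota (tmx N) <-> sse M N.
Proof.
split; last exact: tilde_sse.
(* The functor [G] carries an equality of traces in [Mhat] to an equality of closed systems, whose
   transition matrices are the original ones. *)
have [G [GE _]] := hiota qtraced interp_functor.
have tildeG k (A : 'M_k) :
    fmap G (tilde iota (tmx A)) = qsome (Sys A 0 0 0 : sys 0 0).
  by rewrite -tilde_interp /tilde fmap_trn fmap_hcast GE.
by move=> /(congr1 (fmap G)); rewrite !tildeG => /qsomeP/sequiv_sse.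
Qed.
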